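(* Let $G$ be a finite undirected graph (possibly with loops and multiple edges) with nonempty vertex set $V$ and edge set $E$, and let $b\in\mathbb{R}^V$ be nonzero with all entries nonnegative. The face lattice $\mathcal{F}(\mathcal{P}(G,b))$ of $\mathcal{P}(G,b)$ is isomorphic to the set $\mathcal{G}(G,b)$ of graphs of $\mathcal{P}(G,b)$ partially ordered by inclusion. An isomorphism between these lattices maps each face $F\in\mathcal{F}(\mathcal{P}(G,b))$ to its graph $\mathrm{gr}(F)$, and inversely maps each graph $H\in\mathcal{G}(G,b)$ to the face $\{x\in\mathcal{P}(G,b)\mid\mathrm{gr}(x)\subset H\}=\{x\in\mathcal{P}(G,b)\mid x_e=0\text{ for each }e\in E\text{ which is not an edge of }H\}$. In terms of vertices of faces, $F\in\mathcal{F}(\mathcal{P}(G,b))$ is mapped to the union of the graphs of the vertices of $F$, i.e. $\mathrm{gr}(F)=\bigcup_{u\in\mathrm{vert}(F)}\mathrm{gr}(u)=\mathrm{gr}(\mathrm{vert}(F))$, and $H\in\mathcal{G}(G,b)$ is mapped to the face whose set of vertices is $\{u\in\mathrm{vert}(\mathcal{P}(G,b))\mid\mathrm{gr}(u)\subset H\}$. For any $\mathcal{H}\subset\mathcal{G}(G,b)$, the meet and join of $\mathcal{H}$ in $\mathcal{G}(G,b)$ are \[\inf(\mathcal{H})=\bigcup_{\substack{H\in\mathcal{G}(G,b)\\ H\subset\bigcap_{H'\in\mathcal{H}}H'}}H=\bigcup_{\substack{u\in\mathrm{vert}(\mathcal{P}(G,b))\\ \mathrm{gr}(u)\subset\bigcap_{H'\in\mathcal{H}}H'}}\mathrm{gr}(u),\qquad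 \sup(\mathcal{H})=\bigcup_{H\in\mathcal{H}}H.\]
   Context: $\delta_G(v)$ denotes the set of edges of $G$ incident with $v$; a loop at $v$ appears once in $\delta_G(v)$. $\mathcal{P}(G,b)=\{x\in\mathbb{R}^E \mid x_e\ge 0 \text{ for each } e\in E,\ \sum_{e\in\delta_G(v)}x_e=b_v \text{ for each } v\in V\}$ (a polytope; empty when $E=\emptyset$, since $b\ne0$). $\mathrm{vert}(P)$ is the set of vertices of a polytope $P$. The face lattice $\mathcal{F}(P)$ is the set of all faces of $P$, including $\emptyset$ and $P$, partially ordered by set inclusion. A spanning subgraph of $G$ is a subgraph with vertex set $V$. For $X\subset\mathcal{P}(G,b)$, the graph $\mathrm{gr}(X)$ of $X$ is the spanning subgraph of $G$ with edge set $\{e\in E\mid \text{there exists } x\in X\text{ with }x_e>0\}$, and $\mathrm{gr}(x)=\mathrm{gr}(\{x\})$ for an element $x$. $\mathcal{G}(G,b)=\{\mathrm{gr}(X)\mid X\subset\mathcal{P}(G,b)\}$, whose elements are called the graphs of $\mathcal{P}(G,b)$. Union, intersection and containment ($\subset$, not necessarily proper) of spanning subgraphs of $G$ mean union, intersection and containment of their edge sets; an empty union is the spanning subgraph with no edges, and an empty intersection is taken to be $G$. *)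

(* Defs.v *)
From mathcomp Require Import all_boot all_order all_algebra.
From mathcomp Require Import boolp classical_sets reals.

Set Implicit Arguments.
Unset Strict Implicit.
Unset Printing Implicit Defensive.

Import Order.TTheory GRing.Theory Num.Theory.

Local Open Scope classical_set_scope.
Local Open Scope ring_scope.

(* Finite undirected graphs with vertex set V and edge set E: [ends G e] is the
   set of endpoints of e.  A singleton [ends G e] makes e a loop, and distinct
   edges may have the same endpoints. *)
Record multigraph (V E : finType) := Multigraph {
  ends : E -> {set V};
  ends_card : forall e, (0 < #|ends e| <= 2)%N
}.

(* A loop at v is counted once. *)
Definition incident (V E : finType) (G : multigraph V E) (v : V) : {set E} :=
  [set e | v \in ends G e]%SET.

Definition polytope_of (R : realType) (V E : finType) (G : multigraph V E)
    (b : {ffun V -> R}) : set {ffun E -> R} :=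
  [set x | (forall e, 0 <= x e) /\
           (forall v, \sum_(e in incident G v) x e = b v)].

(* F is the part of P lying on {c . x = d}, for an inequality c . x <= d valid
   on P.  Taking c = 0 with d = 0 or d = 1 yields the faces P and set0. *)
Definition is_face (R : realType) (E : finType) (P F : set {ffun E -> R}) :
    Prop :=
  exists (c : {ffun E -> R}) (d : R),
    (forall x, P x -> \sum_e c e * x e <= d) /\
    F = [set x | P x /\ \sum_e c e * x e = d].

Definition faces (R : realType) (E : finType) (P : set {ffun E -> R}) :
    set (set {ffun E -> R}) := [set F | is_face P F].

(* The vertices are the points u such that {u} is a (0-dimensional) face. *)
Definition vert (R : realType) (E : finType) (P : set {ffun E -> R}) :
    set {ffun E -> R} := [set u | is_face P [set u]].

(* A spanning subgraph of a graph with edge set E is represented by its set of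
   edges, of type [set E]; in particular the whole graph is [setT], which is
   also the value of an empty [\bigcap]. *)
Definition gr (R : realType) (E : finType) (X : set {ffun E -> R}) : set E :=
  [set e | exists2 x, X x & 0 < x e].

Definition graphs_of (R : realType) (V E : finType) (G : multigraph V E)
    (b : {ffun V -> R}) : set (set E) :=
  [set H | exists2 X : set {ffun E -> R}, X `<=` polytope_of G b & H = gr X].

Definition face_of_graph (R : realType) (V E : finType) (G : multigraph V E)
    (b : {ffun V -> R}) (H : set E) : set {ffun E -> R} :=
  [set x | polytope_of G b x /\ gr [set x] `<=` H].

(* f and g are mutually inverse isomorphisms between the families of sets A and
   B, each partially ordered by inclusion. *)
Definition inclusion_iso (T U : Type) (A : set (set T)) (B : set (set U))
    (f : set T -> set U) (g : set U -> set T) : Prop :=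
  [/\ forall X, A X -> B (f X),
      forall Y, B Y -> A (g Y),
      forall X, A X -> g (f X) = X,
      forall Y, B Y -> f (g Y) = Y
    & forall X X', A X -> A X' -> (X `<=` X' <-> f X `<=` f X')].

Definition inclusion_isomorphic (T U : Type) (A : set (set T))
    (B : set (set U)) : Prop := exists f g, inclusion_iso A B f g.

(* Infimum and supremum of S taken in the family A ordered by inclusion. *)
Definition is_inf_in (T : Type) (A S : set (set T)) (Z : set T) : Prop :=
  [/\ A Z, forall X, S X -> Z `<=` X
    & forall Y, A Y -> (forall X, S X -> Y `<=` X) -> Y `<=` Z].

Definition is_sup_in (T : Type) (A S : set (set T)) (Z : set T) : Prop :=
  [/\ A Z, forall X, S X -> X `<=` Z
    & forall Y, A Y -> (forall X, S X -> X `<=` Y) -> Z `<=` Y].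

(* Main.v *)
(* A face F of P(G,b) is determined by its graph: F has a point y whose support
   is gr F, and if gr x is contained in gr F then the segment from x to y can be
   prolonged inside the polytope beyond y, so the hyperplane cutting out F
   contains x.  The empty face is recovered as well because b != 0 keeps 0 out
   of the polytope.  Conversely {x | gr x <= H} is cut out by the inequality
   - sum_(e notin H) x_e <= 0.
   Vertices are the points x that alone lie in the face of gr x; a point of
   least support with x_e > 0 is one, so every edge of gr F is an edge of the
   graph of a vertex of F. *)
Require Import Defs.
From mathcomp Require Import all_boot all_order all_algebra.
From mathcomp Require Import boolp classical_sets reals.
From mathcomp Require Import ring.

Set Implicit Arguments.
Unset Strict Implicit.
Unset Printing Implicit Defensive.

Import Order.TTheory GRing.Theory Num.Theory.

Local Open Scope classical_set_scope.
Local Open Scope ring_scope.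

Section GraphPolytope.
Variables (R : realType) (V E : finType) (G : multigraph V E).
Variables (b : {ffun V -> R}).
Implicit Types (x y c : {ffun E -> R}) (H K : set E) (F X : set {ffun E -> R}).

Let P := polytope_of G b.
Let face H := face_of_graph G b H.

(** * Graphs of sets of points and the faces cut out by edge sets *)

Lemma gr_set1P x e : gr [set x] e <-> 0 < x e.
Proof. by split=> [[_ ->]|xe] //; exists x. Qed.

Lemma gr_mono X X' : X `<=` X' -> gr X `<=` gr X'.
Proof. by move=> XX' e [x Xx xe]; exists x => //; exact: XX'. Qed.

Lemma gr_bigcup X : gr X = \bigcup_(x in X) gr [set x].
Proof.
apply/seteqP; split=> [e [x Xx xe]|e [x Xx /gr_set1P xe]]; exists x => //.
exact/gr_set1P.
Qed.

Lemma face_of_graphP H x :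
  face H x <-> P x /\ (forall e, ~ H e -> x e = 0).
Proof.
split=> -[Px xH]; split=> //.
  move=> e nHe; apply/eqP; rewrite eq_le Px.1 andbT leNgt; apply/negP => xe.
  exact/nHe/xH/gr_set1P.
by move=> e /gr_set1P xe; apply: contrapT => /xH x0; rewrite x0 ltxx in xe.
Qed.

Lemma face_of_graphT : face setT = P.
Proof. by apply/seteqP; split=> [x []|x Px] //; split. Qed.

Lemma gr_face_of_graph H : gr (face H) `<=` H.
Proof. by move=> e [x [_ xH] xe]; exact/xH/gr_set1P. Qed.

Lemma gr_face_of_graphK H : graphs_of G b H -> gr (face H) = H.
Proof.
move=> [X XP ->]; apply/seteqP; split; first exact: gr_face_of_graph.
apply: gr_mono => x Xx; split; first exact: XP.
by apply: gr_mono => _ ->.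
Qed.

Lemma face_of_graph_isface H : is_face P (face H).
Proof.
pose c : {ffun E -> R} := [ffun e => if `[< H e >] then 0 else -1].
have cx x : \sum_e c e * x e = - \sum_(e | ~~ `[< H e >]) x e.
  rewrite -sumrN [RHS]big_mkcond; apply: eq_bigr => e _.
  by rewrite ffunE; case: ifP => _ /=; rewrite ?mul0r ?mulN1r.
exists c, 0; split=> [x Px|].
  by rewrite cx oppr_le0 sumr_ge0// => e _; exact: Px.1.
apply/seteqP; split=> x.
  move=> /face_of_graphP[Px xH]; split=> //.
  by rewrite cx big1 ?oppr0// => e /asboolPn/xH.
move=> [Px /eqP]; rewrite cx oppr_eq0 psumr_eq0 => [/allP x0|e _]; last exact: Px.1.
apply/face_of_graphP; split=> // e nHe; apply/eqP.
have /implyP := x0 e (mem_index_enum e); apply; exact/asboolPn.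
Qed.

(** The inequality that cuts [F] out of [X'] stays valid on the smaller set; this makes a vertex of
    the polytope a vertex of each face containing it. *)
Lemma is_face_restrict X X' F :
  is_face X' F -> F `<=` X -> X `<=` X' -> is_face X F.
Proof.
move=> [c [d [cX' ->]]] FX XX'; exists c, d; split=> [x /XX'/cX'//|].
apply/seteqP; split=> x [Xx cx]; split=> //; last exact: XX'.
by apply: FX.
Qed.

Lemma vert_sub X : vert X `<=` X.
Proof. by move=> u [c [d [_ /seteqP[/(_ u erefl)[Xu _] _]]]]. Qed.

(** * Moving along the line through two points, also beyond them *)

Definition affine_pt x y (t : R) : {ffun E -> R} :=
  [ffun e => x e + t * (y e - x e)].

Lemma sum_affine_pt c x y t :
  \sum_e c e * affine_pt x y t e =
  \sum_e c e * x e + t * (\sum_e c e * y e - \sum_e c e * x e).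
Proof.
rewrite -sumrB mulr_sumr -big_split; apply: eq_bigr => e _ /=.
by rewrite ffunE mulrDr mulrCA mulrBr.
Qed.

Lemma polytope_affine_pt x y t : P x -> P y ->
  (forall e, 0 <= affine_pt x y t e) -> P (affine_pt x y t).
Proof.
move=> [_ xb] [_ yb] z0; split=> // v.
under eq_bigr do rewrite ffunE.
by rewrite big_split -mulr_sumr sumrB /= xb yb subrr mulr0 addr0.
Qed.

Lemma face_of_graph_affine_pt H x y t : face H x -> face H y ->
  (forall e, 0 <= affine_pt x y t e) -> face H (affine_pt x y t).
Proof.
move=> /face_of_graphP[Px xH] /face_of_graphP[Py yH] z0.
apply/face_of_graphP; split; first exact: polytope_affine_pt.
by move=> e nHe; rewrite ffunE xH// yH// subrr mulr0 addr0.
Qed.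

Lemma midpointE x y e : affine_pt x y 2^-1 e = 2^-1 * (x e + y e).
Proof. by rewrite ffunE; field. Qed.

(** Finitely many edges have to be made positive, one at a time, so closure under midpoints is all
    the convexity this takes. *)
Lemma gr_witness X : X !=set0 -> (forall x, X x -> forall e, 0 <= x e) ->
  (forall x y, X x -> X y -> X (affine_pt x y 2^-1)) ->
  exists2 y, X y & gr X `<=` gr [set y].
Proof.
move=> [x0 Xx0] X0 Xmid.
suff [y Xy yX] : exists2 y, X y & forall e, e \in enum E -> gr X e -> 0 < y e.
  exists y => // e Xe; apply/gr_set1P/yX => //; exact: mem_enum.
(* The support of a midpoint is the union of the two supports. *)
elim: (enum E) => [|e s [y Xy ys]]; first by exists x0.
have [[x Xx xe]|nXe] := pselect (gr X e); last first.
  by exists y => // e'; rewrite inE => /predU1P[->//|]; exact: ys.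
have [x_ge0 y_ge0] := (X0 _ Xx, X0 _ Xy).
exists (affine_pt x y 2^-1) => [|e']; first exact: Xmid.
rewrite inE midpointE pmulr_rgt0 ?invr_gt0// => /predU1P[-> _|es Xe'].
  by rewrite ltr_pwDl.
by rewrite ltr_wpDl// ys.
Qed.

(** The ratio test of the simplex method: [t] is the least [x e / - d e] over the decreasing
    coordinates, and a minimiser is the coordinate that reaches 0. *)
Lemma ratio_test (x d : E -> R) : (forall e, 0 <= x e) ->
  (exists e, d e < 0) ->
  exists2 t, 0 <= t & (forall e, 0 <= x e + t * d e) /\
    (exists2 e, d e < 0 & x e + t * d e = 0).
Proof.
move=> x0 [e0 de0].
case: (@Order.TotalTheory.arg_minP _ _ _ e0 (fun e => d e < 0)
  (fun e => x e / - d e) de0) => i di imin.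
have ndi : 0 < - d i by rewrite oppr_gt0.
exists (x i / - d i); first by rewrite divr_ge0// ltW.
split=> [e|]; last by exists i => //; field; rewrite lt_eqF.
have [de|de] := ltP (d e) 0; last by rewrite addr_ge0// mulr_ge0// divr_ge0// ltW.
have := imin e de; rewrite ler_pdivlMr ?oppr_gt0//.
by rewrite mulrN -subr_ge0 opprK.
Qed.

(** At an endpoint of [e] the differences [y e - x e] are nonnegative and sum to 0. Hence the
    direction between distinct points has entries of both signs, and the ratio test applies both
    ways. *)
Lemma polytope_le_eq x y : P x -> P y -> (forall e, x e <= y e) -> x = y.
Proof.
move=> [_ xb] [_ yb] xy; apply/ffunP => e.
have /card_gt0P[v ve] : (0 < #|ends G e|)%N by case/andP: (ends_card G e).
have /eqP : \sum_(e in incident G v) (y e - x e) = 0.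
  by rewrite sumrB xb yb subrr.
rewrite psumr_eq0 => [/allP /(_ e (mem_index_enum e))|e' _]; last by rewrite subr_ge0.
by rewrite inE ve /= subr_eq0 => /eqP.
Qed.

(** * Recovering faces and vertices from their graphs *)

Hypothesis b_neq0 : b != 0.

Lemma polytope_gt0 x : P x -> exists e, 0 < x e.
Proof.
move=> [x0 xb]; apply: contrapT => nx; move/eqP: b_neq0; apply.
apply/ffunP => v; rewrite ffunE -xb big1// => e _.
apply/eqP; rewrite eq_le x0 andbT leNgt; apply/negP => xe.
by apply: nx; exists e.
Qed.

(** Allowing any [face K] in place of the polytope also covers faces of faces, in particular the
    vertices of [face K]. *)
Lemma face_of_face_of_graph K F : is_face (face K) F -> face (gr F) = F.
Proof.
move=> [c [d [cK FE]]].
have FK : F `<=` face K by rewrite FE => x [].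
apply/seteqP; split; last first.
  by move=> x Fx; split; [exact: (FK _ Fx).1|apply: gr_mono => _ ->].
move=> x [Px xF]; have [e0 xe0] := polytope_gt0 Px.
(* An edge in the support of [x] shows that [F] is nonempty, as the choice of [y] below requires. *)
have [x1 Fx1 _] : gr F e0 by apply/xF/gr_set1P.
have [|z Fz e|u v Fu Fv|y Fy yF] := @gr_witness F.
- by exists x1.
- exact: (FK _ Fz).1.1.
- have [u0 v0] := ((FK _ Fu).1.1, (FK _ Fv).1.1).
  move: (Fu) (Fv); rewrite FE => -[Ku cu] [Kv cv]; split.
    apply: face_of_graph_affine_pt => // e.
    by rewrite midpointE mulr_ge0 ?invr_ge0// addr_ge0.
  by rewrite sum_affine_pt cu cv subrr mulr0 addr0.
have Kx : face K x.
  split=> // e /xF Fe; apply: (@gr_face_of_graph K); exact: gr_mono Fe.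
move: (Fy); rewrite FE => -[Ky cy].
(* A positive t with y - t x >= 0 keeps y + t (y - x) nonnegative. *)
have y0 := Ky.1.1.
have [|t t0 [yt [e]]] := @ratio_test y (fun e => - x e) y0.
  by exists e0; rewrite oppr_lt0.
rewrite oppr_lt0 => xe yte.
have ye : 0 < y e by apply/gr_set1P/yF/xF/gr_set1P.
have {t0} t0 : 0 < t.
  rewrite lt_def t0 andbT; apply: contraTneq ye => t_eq0.
  by move: yte; rewrite t_eq0 mul0r addr0 => ->; rewrite ltxx.
(* The inequality at [x] gives one bound; at the point y + t (y - x) beyond [y], where t > 0, it
   gives the reverse one. *)
split=> //; apply/eqP; rewrite eq_le cK//=.
have /cK : face K (affine_pt y x (- t)).
  apply: face_of_graph_affine_pt => // e'; rewrite ffunE.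
  have -> : y e' + - t * (x e' - y e') = (y e' + t * - x e') + t * y e' by ring.
  by rewrite addr_ge0// mulr_ge0// ltW.
by rewrite sum_affine_pt cy gerDl mulNr oppr_le0 pmulr_rge0// subr_ge0.
Qed.

Lemma face_of_graph_gr F : is_face P F -> face (gr F) = F.
Proof. by rewrite -face_of_graphT; exact: face_of_face_of_graph. Qed.

Lemma vert_face_of_graph H :
  vert (face H) = [set u | vert P u /\ gr [set u] `<=` H].
Proof.
apply/seteqP; split=> u.
  move=> uH; split; last exact: (vert_sub uH).2.
  (* The singleton of [u] is the face determined by its own graph, hence also a face of the whole
     polytope. *)
  rewrite /vert /= -(face_of_face_of_graph uH).
  exact: face_of_graph_isface.
move=> [Pu uH].
have Pu' := vert_sub Pu.
by apply: is_face_restrict Pu _ _ => [_ ->|x []].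
Qed.

(* Induction on the support of x: unless x is a vertex, moving away from it along
   a line, in the direction where the coordinate e does not decrease, reaches a
   point of smaller support. *)
Lemma vertex_gt0 H x e : face H x -> 0 < x e ->
  exists2 u, vert (face H) u & 0 < u e.
Proof.
have [n] := ubnP #|[set e | 0 < x e]%SET|; elim: n x => // n IHn x xn Hx xe.
have [x_only|] := pselect (forall y, face (gr [set x]) y -> y = x).
  exists x => //; rewrite vert_face_of_graph; split; last exact: Hx.2.
  rewrite /vert /=.
  have <- : face (gr [set x]) = [set x].
    by apply/seteqP; split=> [y /x_only//|_ ->]; split=> //; exact: Hx.1.
  exact: face_of_graph_isface.
move=> /existsNP[y /not_implyP[[Py yx] y_neq]].
have [Px x0] := (Hx.1, Hx.1.1).
have Hy : face H y by split=> //; exact: subset_trans yx Hx.2.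
suff [t [z0 ze [e' xe' ze']]] : exists t : R,
    [/\ forall e, 0 <= affine_pt x y t e, 0 < affine_pt x y t e
      & exists2 e', 0 < x e' & affine_pt x y t e' = 0].
  apply: (IHn (affine_pt x y t)) => //; last exact: face_of_graph_affine_pt.
  rewrite -ltnS; apply: leq_trans xn; rewrite ltnS; apply: proper_card.
  (* Coordinates that vanish at [x] vanish at [y] too, hence on the whole line; [e'] is a new
     zero. *)
  apply/properP; split.
    apply/fintype.subsetP => i; rewrite !inE => zi; rewrite lt_def x0 andbT.
    apply: contraTneq zi => xi; rewrite ffunE xi.
    have [_ yi] := (face_of_graphP _ _).1 (conj Py yx).
    rewrite yi ?subrr ?mulr0 ?addr0 ?ltxx//.
    by move=> /gr_set1P; rewrite xi ltxx.
  by exists e'; rewrite inE// ze' ltxx.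
(* The sign [s], 1 or -1, orients the line so that [e] does not decrease. *)
have step (s : R) : 0 <= s * (y e - x e) -> (exists e', s * (y e' - x e') < 0) ->
    exists t : R,
    [/\ forall e, 0 <= affine_pt x y t e, 0 < affine_pt x y t e
      & exists2 e', 0 < x e' & affine_pt x y t e' = 0].
  move=> de dlt; have [t t0 [zt [e' de' ze']]] := ratio_test x0 dlt.
  have zE i : affine_pt x y (t * s) i = x i + t * (s * (y i - x i)).
    by rewrite ffunE mulrA.
  exists (t * s); split.
  - by move=> i; rewrite zE.
  - by rewrite zE ltr_pwDl// mulr_ge0.
  exists e'; last by rewrite zE.
  rewrite lt_def x0 andbT; apply: contraTneq de' => xe'.
  have [_ ye'] := (face_of_graphP _ _).1 (conj Py yx).
  rewrite xe' ye' ?subrr ?mulr0 ?ltxx//.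
  by move=> /gr_set1P; rewrite xe' ltxx.
have [xy_e|yx_e] := leP (x e) (y e).
  apply: (step 1); first by rewrite mul1r subr_ge0.
  apply: contrapT => noneg; apply/y_neq/esym/polytope_le_eq => // i.
  by rewrite leNgt; apply/negP => ?; apply: noneg; exists i; rewrite mul1r subr_lt0.
apply: (step (-1)); first by rewrite mulN1r opprB subr_ge0 ltW.
apply: contrapT => noneg; apply/y_neq/polytope_le_eq => // i.
by rewrite leNgt; apply/negP => ?; apply: noneg; exists i; rewrite mulN1r opprB subr_lt0.
Qed.

Lemma gr_vert_face_of_graph H : gr (vert (face H)) = gr (face H).
Proof.
apply/seteqP; split=> [|e [x Hx xe]].
  by apply: gr_mono; exact: vert_sub.
by have [u uH ue] := vertex_gt0 Hx xe; exists u.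
Qed.

(** * Joins and meets of graphs *)

Lemma graphs_of_bigcup (HH : set (set E)) :
  HH `<=` graphs_of G b -> graphs_of G b (\bigcup_(H in HH) H).
Proof.
(* The union is the graph of the face it determines, since the points producing each [H] lie in that
   face. *)
move=> HHG; exists (face (\bigcup_(H in HH) H)) => [x []//|].
apply/seteqP; split; last exact: gr_face_of_graph.
move=> e [H HHH He]; have [X XP HX] := HHG _ HHH.
move: (He); rewrite HX => -[x Xx xe]; exists x => //; split; first exact: XP.
by move=> i xi; exists H => //; rewrite HX; apply: gr_mono xi => _ ->.
Qed.

(** Both unions equal [gr (face K)], the largest graph contained in [K]. *)
Lemma bigcup_graphs_vert K :
  \bigcup_(H in [set H | graphs_of G b H /\ H `<=` K]) H =
  \bigcup_(u in [set u | vert P u /\ gr [set u] `<=` K]) gr [set u].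
Proof.
rewrite -vert_face_of_graph -gr_bigcup gr_vert_face_of_graph.
apply/seteqP; split=> e.
  move=> [H [GH HK]]; rewrite -(gr_face_of_graphK GH); apply: gr_mono => x [Px xH].
  by split=> //; exact: subset_trans HK.
move=> Ke; exists (gr (face K)) => //; split; last exact: gr_face_of_graph.
by exists (face K) => // x [].
Qed.

End GraphPolytope.

Theorem theorem33 (R : realType) (V E : finType) (G : multigraph V E)
    (b : {ffun V -> R}) (hV : (0 < #|V|)%N)
    (hb : b != 0) (hb0 : forall v : V, 0 <= b v) :
  inclusion_isomorphic (faces (polytope_of G b)) (graphs_of G b)
  /\ inclusion_iso (faces (polytope_of G b)) (graphs_of G b)
       (fun F => gr F) (fun H => face_of_graph G b H)
  /\ (forall H : set E, graphs_of G b H ->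
        face_of_graph G b H =
        [set x | polytope_of G b x /\ forall e : E, ~ H e -> x e = 0])
  /\ (forall F : set {ffun E -> R}, faces (polytope_of G b) F ->
        gr F = \bigcup_(u in vert F) gr [set u] /\
        \bigcup_(u in vert F) gr [set u] = gr (vert F))
  /\ (forall H : set E, graphs_of G b H ->
        vert (face_of_graph G b H) =
          [set u | vert (polytope_of G b) u /\ gr [set u] `<=` H] /\
        (forall F : set {ffun E -> R}, faces (polytope_of G b) F ->
           vert F = [set u | vert (polytope_of G b) u /\ gr [set u] `<=` H] ->
           F = face_of_graph G b H))
  /\ (forall HH : set (set E), HH `<=` graphs_of G b ->
        is_inf_in (graphs_of G b) HH
          (\bigcup_(H in [set H | graphs_of G b H /\
                                  H `<=` \bigcap_(H' in HH) H']) H) /\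
        \bigcup_(H in [set H | graphs_of G b H /\
                               H `<=` \bigcap_(H' in HH) H']) H =
          \bigcup_(u in [set u | vert (polytope_of G b) u /\
                                 gr [set u] `<=` \bigcap_(H' in HH) H'])
             gr [set u] /\
        is_sup_in (graphs_of G b) HH (\bigcup_(H in HH) H)).
Proof.
have iso : inclusion_iso (faces (polytope_of G b)) (graphs_of G b)
    (fun F => gr F) (fun H => face_of_graph G b H).
  split=> [F [c [d [_ ->]]]|H _|F /(face_of_graph_gr hb)//|H|F F' PF PF'].
  - by eexists; last reflexivity; move=> x [].
  - exact: face_of_graph_isface.
  - exact: gr_face_of_graphK.
  split; first exact: gr_mono.
  rewrite -{2}(face_of_graph_gr hb PF) -{2}(face_of_graph_gr hb PF').
  by move=> FF' x [Px xF]; split=> //; exact: subset_trans FF'.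
have gr_vert F : faces (polytope_of G b) F -> gr (vert F) = gr F.
  by move=> PF; rewrite -(face_of_graph_gr hb PF) gr_vert_face_of_graph.
split; [by do 2 eexists; exact: iso|split; first exact: iso].
split; [|split; [|split]].
- by move=> H _; apply/seteqP; split=> x /face_of_graphP.
- by move=> F PF; rewrite -gr_bigcup gr_vert.
- move=> H GH; split=> [|F PF]; first exact: vert_face_of_graph.
  rewrite -vert_face_of_graph// => vF.
  (* A face is determined by its graph, and its graph by its vertices. *)
  rewrite -(face_of_graph_gr hb PF) -(gr_vert _ PF) vF gr_vert_face_of_graph//.
  by rewrite gr_face_of_graphK.
move=> HH HHG; split; [|split].
- split.
  + by apply: graphs_of_bigcup => H [].
  + by move=> H HHH e [H' [_ H'HH] /H'HH]; exact.
  + by move=> H GH HHH e He; exists H => //; split=> // i Hi H' /HHH; exact.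
- exact: bigcup_graphs_vert.
- split; first exact: graphs_of_bigcup.
  + by move=> H HHH e He; exists H.
  + by move=> H _ HHH e [H' /HHH]; exact.
Qed.
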